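(* Let $(X,T)$ be a transitive system, let $n\ge 2$, and let $\mathcal{F}=\mathcal{F}_{ps}$ or $\mathcal{F}=\mathcal{F}_{pubd}$. Then $(X,T)$ is broken $\mathcal{F}$-$n$-sensitive if and only if there exists an essential $n$-sensitive tuple of $(X,T)$ which is an $\mathcal{F}$-recurrent point of $(X^n,T^{(n)})$.
   Context: A (topological dynamical) system $(X,T)$ is a compact metric space $X$ with metric $d$ and a continuous surjective map $T\colon X\to X$. $(X^n,T^{(n)})$ is the $n$-fold product system with $T^{(n)}=T\times\cdots\times T$. $\mathbb{Z}_+=\{0,1,2,\dots\}$, $\mathbb{N}=\{1,2,\dots\}$. ''Opene'' means non-empty open. $(X,T)$ is transitive if for all opene $U,V\subset X$ the set $\{k\in\mathbb{Z}_+: U\cap T^{-k}V\ne\emptyset\}$ is infinite. A Furstenberg family is a collection of subsets of $\mathbb{Z}_+$ that is closed under taking supersets in $\mathbb{Z}_+$. A set $A\subset\mathbb{Z}_+$ is thick if for every $l\ge1$ there is $n_l\in\mathbb{N}$ with $\{n_l,n_l+1,\dots,n_l+l\}\subset A$; syndetic if there is $N\in\mathbb{N}$ such that $\{k,k+1,\dots,k+N\}\cap A\ne\emptyset$ for every $k\in\mathbb{N}$; piecewise syndetic if it is the intersection of a thick set and a syndetic set. $\mathcal{F}_{ps}$ is the family of piecewise syndetic subsets of $\mathbb{Z}_+$. $\mathcal{F}_{pubd}$ is the family of $A\subset\mathbb{Z}_+$ with positive upper Banach density, i.e. $\limsup_{b-a\to\infty}\frac{|A\cap\{a,a+1,\dots,b-1\}|}{b-a}>0$.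 For a family $\mathcal{F}$ and a system $(Y,S)$, a point $y\in Y$ is $\mathcal{F}$-recurrent if $\{k\in\mathbb{Z}_+: S^ky\in U\}\in\mathcal{F}$ for every neighbourhood $U$ of $y$. $(X,T)$ is broken $\mathcal{F}$-$n$-sensitive if there exist $\delta>0$ and $F\in\mathcal{F}$ such that for every opene $U\subset X$ and every $l\in\mathbb{N}$ there exist $x_1^l,\dots,x_n^l\in U$ and $m_l\in\mathbb{Z}_+$ with $\min_{1\le i<j\le n}d(T^kx_i^l,T^kx_j^l)>\delta$ for all $k\in m_l+(F\cap[1,l])$. A tuple $(x_1,\dots,x_n)\in X^n$ whose coordinates are not all equal is an $n$-sensitive tuple if for every opene $U\subset X$ and all open neighbourhoods $U_i$ of $x_i$ ($1\le i\le n$) there exist $y_1,\dots,y_n\in U$ and $m\in\mathbb{N}$ with $T^my_i\in U_i$ for all $i$. It is essential if moreover $x_i\ne x_j$ for all $i\ne j$. *)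

(* Defs.v *)
From mathcomp Require Import all_boot all_order all_algebra.
From mathcomp Require Import all_classical all_reals ereal topology normedtype.
Set Implicit Arguments.
Unset Strict Implicit.
Unset Printing Implicit Defensive.
Import Order.TTheory GRing.Theory Num.Theory.
Local Open Scope classical_set_scope.
Local Open Scope ring_scope.

(* The empty space is excluded separately, where it matters. *)
Definition is_system (R : realType) (X : metricType R) (T : X -> X) : Prop :=
  [/\ compact [set: X], continuous T & set_surj [set: X] [set: X] T].

Definition transitive_system (X : topologicalType) (T : X -> X) : Prop :=
  forall U V : set X, open U -> U !=set0 -> open V -> V !=set0 ->
    infinite_set [set k : nat | (U `&` iter k T @^-1` V) !=set0].

Definition thick (A : set nat) : Prop :=
  forall l : nat, (1 <= l)%N ->
    exists2 m : nat, (1 <= m)%N & forall i : nat, (i <= l)%N -> A (m + i)%N.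

Definition syndetic (A : set nat) : Prop :=
  exists2 N : nat, (1 <= N)%N &
    forall k : nat, (1 <= k)%N -> exists2 i : nat, (i <= N)%N & A (k + i)%N.

Definition Fps : set (set nat) :=
  [set A | exists B C : set nat, [/\ thick B, syndetic C & A = B `&` C]].

(* The filter of pairs (a, b) with b - a tending to infinity. *)
Definition long_windows : set_system (nat * nat) :=
  filter_from [set: nat] (fun N => [set p | (p.1 + N <= p.2)%N]).

(* |A `&` {a, ..., b-1}| / (b - a), with value 0 on the empty window a = b. *)
Definition window_density (R : realType) (A : set nat) (p : nat * nat) : R :=
  (\sum_(p.1 <= k < p.2) (k \in A))%N%:R / (p.2 - p.1)%N%:R.

Definition upper_banach_density (R : realType) (A : set nat) : \bar R :=
  limf_esup (fun p => (window_density R A p)%:E) long_windows.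

Definition Fpubd (R : realType) : set (set nat) :=
  [set A | (0 < upper_banach_density R A)%E].

Definition recurrent_point (F : set (set nat)) (Y : topologicalType)
    (S : Y -> Y) (y : Y) : Prop :=
  forall U : set Y, nbhs y U -> F [set k : nat | U (iter k S y)].

Definition power_map (X : topologicalType) (n : nat) (T : X -> X)
    (x : {ptws 'I_n -> X}) : {ptws 'I_n -> X} := fun i => T (x i).

(* The condition "min over i < j of the distances is > delta" is unfolded to
   all pairs i < j. *)
Definition broken_sensitive (R : realType) (X : metricType R) (T : X -> X)
    (F : set (set nat)) (n : nat) : Prop :=
  exists delta : R, exists A : set nat, [/\ 0 < delta, F A &
    forall U : set X, open U -> U !=set0 -> forall l : nat, (1 <= l)%N ->
      exists (x : 'I_n -> X) (m : nat), (forall i, U (x i)) /\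
        forall k : nat,
          [set (m + f)%N | f in A `&` [set f : nat | (1 <= f <= l)%N]] k ->
          forall i j : 'I_n, (i < j)%N ->
            delta < mdist (iter k T (x i)) (iter k T (x j))].

Definition sensitive_tuple (X : topologicalType) (T : X -> X) (n : nat)
    (x : 'I_n -> X) : Prop :=
  (exists i j : 'I_n, x i <> x j) /\
  forall U : set X, open U -> U !=set0 ->
  forall V : 'I_n -> set X, (forall i, open_nbhs (x i) (V i)) ->
    exists (y : 'I_n -> X) (m : nat),
      [/\ forall i, U (y i), (1 <= m)%N & forall i, V i (iter m T (y i))].

Definition essential_sensitive_tuple (X : topologicalType) (T : X -> X)
    (n : nat) (x : 'I_n -> X) : Prop :=
  sensitive_tuple T x /\ forall i j : 'I_n, i != j -> x i <> x j.

(* Main.v *)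
Require Import Defs.
From mathcomp Require Import all_boot all_order all_algebra.
From mathcomp Require Import all_classical all_reals ereal topology normedtype.
From mathcomp Require Import zify lra.
Set Implicit Arguments.
Unset Strict Implicit.
Unset Printing Implicit Defensive.
Import Order.TTheory GRing.Theory Num.Theory.
Local Open Scope classical_set_scope.

(** The backward implication is direct: take the return times of the recurrent
tuple [x] to a small box around itself as the set [A]; sensitivity brings points
of any open set [U] so close to [x] that they follow its orbit for [l] steps,
and at times of [A] that orbit is back near [x], whose entries are far apart.

For the forward implication, transitivity and compactness first give one tuple
[z], a limit of images of tuples starting in ever smaller open sets, such that
the iterate [T^k z] lies in a certain compact set [K] for every positive [k] in
[A] ([broken_limit_tuple]). Here [K] consists of the tuples with entries at
pairwise distance at least delta that satisfy the sensitivity condition, so all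
of its points are essential sensitive tuples. It remains to find a point of [K]
that is recurrent along the family, knowing only that some orbit visits [K]
along a member of the family.

Such a point is produced by a scheme that uses neither minimal sets nor
invariant measures. Say that a closed set [C] is large when it is visited by
orbits in the way the family prescribes, uniformly on arbitrarily long windows.
Largeness has two properties ([large_notion]): if [C `|` D] is large then [C] or
[D] is; and every large [C] contains a large closed [E] all of whose points
return to [C] along a member of the family. By the first property one can cut
[E] down to a large set of small diameter, so there is a decreasing sequence of
large closed sets [C_j] of diameters tending to 0 such that the points of
[C_j.+1] return to [C_j] along the family. The common point of the [C_j] is
recurrent ([large_recurrent]).

For piecewise syndetic sets, [E] collects the points of [C] that visit [C] with
gaps bounded by a suitable constant. For positive upper Banach density, there is
a point [y] that visits [C] with frequency at least 1/q on every initial segment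
of times, and [E] collects the points of [C] that do so with frequency at least
1/(2q). A visit of [y] to [C] outside [E] starts a segment of lower frequency;
such segments can be chosen disjoint ([leapfrog]), so these visits have
frequency at most 1/(2q), and visits to [E] of frequency at least 1/(2q) remain.
*)

(** * Orbits, visits and nested closed sets *)

Definition visits (Y : Type) (S : Y -> Y) (y : Y) (C : set Y) : set nat :=
  [set k | C (iter k S y)].

Definition hits_in (A : set nat) (a b : nat) : nat :=
  (\sum_(a <= k < b) (k \in A))%N.

Lemma visits_shift (Y : Type) (S : Y -> Y) (y : Y) (C : set Y) (a k : nat) :
  visits S (iter a S y) C k = visits S y C (a + k)%N.
Proof. by rewrite /visits /= addnC iterD. Qed.

Lemma iter_continuous (Y : topologicalType) (S : Y -> Y) (k : nat) :
  continuous S -> continuous (iter k S).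
Proof.
move=> cS; elim: k => [|k IHk] x; first exact: cvg_id.
exact: (continuous_comp (IHk x) (cS _)).
Qed.

Lemma nested_closed_inhabited (Y : topologicalType) (C : nat -> set Y) :
  compact [set: Y] -> (forall j, closed (C j)) -> (forall j, C j !=set0) ->
  (forall j, C j.+1 `<=` C j) -> exists x, forall j, C j x.
Proof.
move=> cptY clC neC decC.
have decCn i j : (i <= j)%N -> C j `<=` C i.
  move=> /subnK <-; elim: (j - i)%N => [|m IHm] x //.
  by rewrite addSn => /decC /IHm.
have [] := cptY (filter_from setT C).
- apply: filter_from_proper => //.
  apply: filter_from_filter; first by exists 0%N.
  move=> i j _ _; exists (maxn i j) => // x Cx.
  by split; apply: decCn Cx; rewrite (leq_maxl, leq_maxr).
- by exists 0%N.
- move=> x [_ clx]; exists x => j; apply: clC => B Bx.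
  by apply: clx Bx; exists j.
Qed.

(** * Recurrent points in large closed sets *)

(** The properties of a notion of largeness [P] on closed sets that make every
large set contain a point recurrent along the family [F]. The superset [U] in
the last field spares a separate proof that [F] is closed under supersets. *)
Record large_notion (Y : topologicalType) (S : Y -> Y) (F : set (set nat))
    (P : set Y -> Prop) : Prop := LargeNotion {
  large_nonempty : forall C, P C -> C !=set0;
  large_split : forall C D, closed C -> closed D ->
    P (C `|` D) -> P C \/ P D;
  large_returns : forall C, closed C -> P C ->
    exists E, [/\ closed E, E `<=` C, P E &
      forall x, E x -> forall U, C `<=` U -> F (visits S x U)] }.

Section recurrence.
Context {R : realType} {Y : pseudoMetricType R} (S : Y -> Y).
Context (F : set (set nat)) (P : set Y -> Prop).
Hypothesis Y_compact : compact [set: Y].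
Hypothesis P_large : large_notion S F P.

(** Partition regularity and compactness concentrate a large set near a point:
the sets [C `\` D] with [C `&` D] not large form a filter base, and any cluster
point of that filter will do. *)
Lemma large_localizes (C : set Y) : closed C -> P C ->
  exists2 x, C x & forall V, closed V -> nbhs x V -> P (C `&` V).
Proof.
move=> clC PC.
pose small D := closed D /\ ~ P (C `&` D).
pose G := filter_from small (fun D => C `\` D).
have ne := large_nonempty P_large; have split_ := large_split P_large.
have GF : ProperFilter G.
  apply: filter_from_proper; last first.
    move=> D [_ nPD]; apply: contrapT => /nonemptyPn CD0; apply: nPD.
    suff -> : C `&` D = C by [].
    apply/setIidPl => x Cx; apply: contrapT => nDx.
    by rewrite -subset0 in CD0; exact: (CD0 x).
  apply: filter_from_filter.
    exists set0; split; first exact: closed0.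
    by rewrite setI0 => /ne [].
  move=> D1 D2 [cl1 nP1] [cl2 nP2]; exists (D1 `|` D2); last first.
    by rewrite setDUr.
  split; first exact: closedU.
  by rewrite setIUr => /split_ [|||]; try exact: closedI.
have GC : G C.
  exists set0; last exact: subDsetl.
  by split; [exact: closed0|rewrite setI0 => /ne []].
have cptC := @subclosed_compact _ C setT clC Y_compact (@subsetT _ _).
have [x [Cx clx]] := cptC G GF GC.
exists x => // V clV Vx; apply: contrapT => nPV.
have [|z [[_ nVz] Vz]] := clx (C `\` V) V _ Vx; last exact: nVz.
by exists V.
Qed.

Lemma large_refine (C : set Y) (e : R) : closed C -> P C -> (0 < e)%R ->
  exists E, [/\ closed E, E `<=` C, P E,
    (forall x, E x -> E `<=` ball x e) &
    forall x, E x -> forall U, C `<=` U -> F (visits S x U)].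
Proof.
move=> clC PC e0; have [E [clE EC PE ret]] := large_returns P_large clC PC.
have [x Ex /(_ (closed_ball x (e / 2 / 2)%R))] := large_localizes clE PE.
have e40 : (0 < e / 2 / 2)%R by rewrite !divr_gt0.
have clB := @closed_ball_closed R Y x (e / 2 / 2)%R.
move=> /(_ clB) loc; exists (E `&` closed_ball x (e / 2 / 2)%R); split.
- exact: closedI.
- by move=> y [/EC].
- apply: loc; apply: filterS (nbhsx_ballx x _ e40).
  exact: subset_closure.
- have sub := @subset_closure_half _ _ x (e / 2)%R ltac:(by rewrite divr_gt0).
  move=> y [_ /sub /ball_sym xy] z [_ /sub xz].
  by rewrite (splitr e); exact: ball_triangle xz.
- by move=> y [/ret].
Qed.

(** Choose [C_j.+1] in [C_j] by [large_refine] with radius 1/(j+1). The common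
point [x] of these sets lies in [C_j.+2], so it returns along [F] to [C_j.+1],
which is contained in any prescribed neighbourhood of [x] for [j] large. *)
Lemma large_recurrent (K : set Y) : closed K -> P K ->
  exists2 x, K x & recurrent_point F S x.
Proof.
move=> clK PK.
pose lset := {C : set Y | closed C /\ P C}.
pose good (j : nat) (C E : set Y) := [/\ E `<=` C,
  (forall x, E x -> E `<=` ball x (j.+1%:R^-1)%R) &
    forall x, E x -> forall U, C `<=` U -> F (visits S x U)].
have step (p : nat * lset) : exists E : lset, good p.1 (sval p.2) (sval E).
  case: p => j [C [clC PC]] /=.
  have [|E [clE EC PE small ret]] := @large_refine C (j.+1%:R^-1)%R clC PC.
    by rewrite invr_gt0 ltr0Sn.
  by exists (exist _ E (conj clE PE)).
have [f fP] := choice step.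
pose C := fix C j := if j is i.+1 then f (i, C i) else exist _ K (conj clK PK).
have Cgood j : good j (sval (C j)) (sval (C j.+1)) by exact: (fP (j, C j)).
have [|||x Cx] := @nested_closed_inhabited Y (fun j => sval (C j)) Y_compact.
- by move=> j; case: (svalP (C j)).
- by move=> j; case: (svalP (C j)) => _ /(large_nonempty P_large).
- by move=> j; case: (Cgood j).
exists x; first exact: (Cx 0%N).
move=> U /nbhs_ballP[e /= e0 xeU].
have [j je] : exists j : nat, (j.+1%:R^-1 < e)%R.
  by have [j _ /(_ j (leqnn j))] := near_infty_natSinv_lt (PosNum e0); exists j.
have [_ small _] := Cgood j; have [_ _ ret] := Cgood j.+1.
apply: (ret x (Cx j.+2)) => y Cy; apply: xeU.
by apply: le_ball (ltW je) _ _; exact: small (Cx j.+1) _ Cy.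
Qed.

End recurrence.

(** * Piecewise syndetic visits *)

Definition met_within (N : nat) (A : set nat) (k : nat) : Prop :=
  exists2 i, (i <= N)%N & A (k + i)%N.

(** The finite windows of visits are required of possibly different points, so
that the condition can be verified along one orbit and passes to limits. *)
Definition ps_visited (Y : Type) (S : Y -> Y) (C : set Y) : Prop :=
  exists N, forall L, exists y, forall k, (k <= L)%N ->
    met_within N (visits S y C) k.

Lemma closed_met_within (Y : topologicalType) (S : Y -> Y) (C : set Y)
    (N k : nat) : continuous S -> closed C ->
  closed [set y | met_within N (visits S y C) k].
Proof.
move=> cS clC.
rewrite (_ : [set y | _] =
    \bigcup_(i in [set i | (i <= N)%N]) (iter (k + i) S @^-1` C)) //.
apply: closed_bigcup => [|i _].
  by apply: (sub_finite_set _ (finite_II N.+1)) => i.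
by apply: preimage_closed clC => y _; exact: iter_continuous.
Qed.

Lemma ps_visited_everywhere (Y : topologicalType) (S : Y -> Y) (C : set Y) :
  compact [set: Y] -> continuous S -> closed C -> ps_visited S C ->
  exists N y, forall k, met_within N (visits S y C) k.
Proof.
move=> cptY cS clC [N psC]; exists N.
have [||||y Cy] := @nested_closed_inhabited Y
  (fun L => [set y | forall k, (k <= L)%N -> met_within N (visits S y C) k]).
- exact: cptY.
- move=> L; rewrite (_ : [set y | _] = \bigcap_(k in [set k | (k <= L)%N])
    [set y | met_within N (visits S y C) k]); last by [].
  by apply: closed_bigI => k _; exact: closed_met_within.
- by move=> L; have [y Cy] := psC L; exists y.
- by move=> L y Cy k kL; apply: Cy; exact: leqW.
- by exists y => k; exact: (Cy k).
Qed.

Lemma syndetic_Fps (A : set nat) : syndetic A -> Fps A.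
Proof.
move=> sA; exists setT, A; split=> //; last by rewrite setTI.
by move=> l _; exists 1%N.
Qed.

Lemma Fps_positive (A : set nat) : Fps A -> exists2 k, (1 <= k)%N & A k.
Proof.
move=> [B [C [thickB [N N1 syndC] ->]]].
have [m m1 mB] := thickB N N1; have [i iN Ci] := syndC m m1.
by exists (m + i)%N; [rewrite addn_gt0 m1|split=> //; exact: mB].
Qed.

(** If an orbit visits [C `|` D] with bounded gaps but [D] with unbounded gaps,
then inside the long gaps of [D] it is [C] that is visited with bounded gaps. *)
Lemma ps_visited_large (Y : topologicalType) (S : Y -> Y) :
  compact [set: Y] -> continuous S -> large_notion S Fps (ps_visited S).
Proof.
move=> cptY cS; split.
- move=> C [N /(_ 0%N)[y /(_ 0%N (leqnn _))[i _ Cy]]].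
  by eexists; exact: Cy.
- move=> C D clC clD /(ps_visited_everywhere cptY cS (closedU clC clD)).
  move=> [N [y CDy]].
  have [[M My]|nD] := pselect (exists M, forall k,
      met_within M (visits S y D) k).
    by right; exists M => L; exists y => k _; exact: My.
  (* The extra N keeps the windows that start at times up to L free of D. *)
  left; exists N => L; apply: contrapT => nC; apply: nD; exists (L + N)%N => a.
  apply: contrapT => Da; apply: nC; exists (iter a S y) => k kL.
  have [i iN [Cy|Dy]] := CDy (a + k)%N; exists i => //;
    rewrite visits_shift addnA //.
  case: Da; exists (k + i)%N; first exact: leq_add.
  by rewrite addnA.
- move=> C clC /(ps_visited_everywhere cptY cS clC)[N [y Cy]].
  exists (C `&` [set x | forall k, met_within N (visits S x C) k]); split.
  + apply: closedI => //.
    rewrite (_ : [set y | _] = \bigcap_k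
      [set y | met_within N (visits S y C) k]).
      by apply: closed_bigI => k _; exact: closed_met_within.
    by apply/seteqP; split=> x Cx k; [move=> _|]; exact: Cx.
  + exact: subIsetl.
  + exists N => L; exists y => k _; have [i iN Cki] := Cy k.
    exists i => //; split=> // m; have [j jN Ckj] := Cy (k + i + m)%N.
    by exists j => //; rewrite visits_shift addnA.
  + move=> x [_ Cx] U CU; apply: syndetic_Fps; exists N.+1 => // k _.
    by have [i iN Cki] := Cx k; exists i; [exact: leqW|exact: CU].
Qed.

Lemma Fps_ps_visited (Y : Type) (S : Y -> Y) (K : set Y) (z : Y)
    (A : set nat) : Fps A ->
  (forall k, (1 <= k)%N -> A k -> K (iter k S z)) -> ps_visited S K.
Proof.
move=> [B [C [thickB [N _ syndC] ->]]] AK; exists N => L.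
have [|m m1 mB] := thickB (L + N).+1; first by [].
exists (iter m S z) => k kL; have [|i iN Ci] := syndC (m + k)%N.
  by rewrite addn_gt0 m1.
exists i => //; rewrite visits_shift; apply: AK.
  by rewrite addn_gt0 m1.
split; last by rewrite addnA.
by apply: mB; apply: leqW; exact: leq_add.
Qed.

(** * Visits of positive upper Banach density *)

Lemma hits_in_cat (A : set nat) (a b c : nat) : (a <= b)%N -> (b <= c)%N ->
  hits_in A a c = (hits_in A a b + hits_in A b c)%N.
Proof. exact: big_cat_nat. Qed.

Lemma hits_in_sub (A B : set nat) (a b : nat) :
  (forall k, (a <= k < b)%N -> A k -> B k) ->
  (hits_in A a b <= hits_in B a b)%N.
Proof.
move=> AB; rewrite /hits_in !big_nat; apply: leq_sum => k kab.
by have [Ak|//] := boolP (k \in A); rewrite (mem_set (AB k kab (set_mem Ak))).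
Qed.

Lemma hits_in_setU (A B : set nat) (a b : nat) :
  (hits_in (A `|` B) a b <= hits_in A a b + hits_in B a b)%N.
Proof.
rewrite /hits_in -big_split /=; apply: leq_sum => k _.
by rewrite in_setU; case: (k \in A); case: (k \in B).
Qed.

Lemma hits_in_shift (Y : Type) (S : Y -> Y) (y : Y) (C : set Y) (a b : nat) :
  hits_in (visits S (iter a S y) C) 0 b = hits_in (visits S y C) a (a + b).
Proof.
rewrite /hits_in -{2}[a]add0n big_addn addKn; apply: eq_bigr => k _.
congr (nat_of_bool _); apply/idP/idP; rewrite !inE;
  by rewrite visits_shift addnC.
Qed.

(** Replaces the limit superior of real densities by counting in natural
numbers. *)
Lemma Fpubd_windows (R : realType) (A : set nat) : Fpubd R A <->
  exists q, forall N, exists a b,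
    (a + N <= b)%N /\ (b - a <= q * hits_in A a b)%N.
Proof.
split=> [posA|[q winA]].
- have [c c0 cA] : exists2 c : R, (0 < c)%R &
      (c%:E < upper_banach_density R A)%E.
    move: posA; rewrite /Fpubd /=.
    case: (upper_banach_density R A) => [r| |] //.
      by rewrite lte_fin => r0; exists (r / 2)%R; rewrite ?lte_fin; lra.
    by move=> _; exists 1%R; rewrite ?ltry.
  exists (Num.bound c^-1) => N.
  have /ereal_sup_gt[_ [[a b] /= aNb <-]] : (c%:E <
      ereal_sup ((fun p => (window_density R A p)%:E) @`
        [set p | (p.1 + N <= p.2)%N]))%E.
    apply: (lt_le_trans cA); apply: ereal_inf_lbound.
    by exists [set p | (p.1 + N <= p.2)%N] => //; exists N.
  rewrite lte_fin /window_density /= -/(hits_in A a b) => cab.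
  exists a, b; split=> //; have [->//|ba0] := eqVneq (b - a)%N 0%N.
  have pos : (0 < (b - a)%:R :> R)%R by rewrite ltr0n lt0n.
  move: cab; rewrite ltr_pdivlMr // => cab.
  have qc : (c^-1 < (Num.bound c^-1)%:R)%R.
    by apply: archi_boundP; rewrite invr_ge0 ltW.
  have h0 : (0 <= (hits_in A a b)%:R :> R)%R by exact: ler0n.
  rewrite -(ler_nat R) natrM.
  have : ((b - a)%:R <= c^-1 * (hits_in A a b)%:R :> R)%R.
    by rewrite mulrC ler_pdivlMr // mulrC ltW.
  move/le_trans; apply; exact: ler_wpM2r (ltW qc).
- have q0 : (0 < q)%N.
    have [a [b [+ +]]] := winA 1%N; case: q {winA} => //; rewrite mul0n; lia.
  rewrite /Fpubd /=; apply: (@lt_le_trans _ _ (q%:R^-1)%:E).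
    by rewrite lte_fin invr_gt0 ltr0n.
  apply: le_ereal_inf_tmp => _ [V [N _ NV] <-].
  have [a [b [aNb ab]]] := winA N.+1.
  apply: (@le_trans _ _ (window_density R A (a, b))%:E).
    rewrite lee_fin /window_density /= -/(hits_in A a b).
    have ba0 : (0 < b - a)%N by lia.
    rewrite ler_pdivlMr ?ltr0n // ler_pdivrMl ?ltr0n //.
    by rewrite -natrM ler_nat.
  by apply: ereal_sup_ubound; exists (a, b) => //; apply: NV => /=; lia.
Qed.

(** The one-dimensional covering argument. It is applied with [P n] saying that
some set of times has low frequency among the times below [n], which persists
when an adjacent segment of low frequency is added. The relation [jump] records
how far the last segment may protrude beyond [L]. *)
Lemma leapfrog (P : nat -> Prop) (jump : nat -> nat -> Prop) : P 0%N ->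
  (forall k, jump k k) ->
  (forall k, P k -> exists n, [/\ (k < n)%N, jump k n & P n]) ->
  forall L, exists k n, [/\ (k <= L <= n)%N, jump k n & P n].
Proof.
move=> P0 jump0 next; elim=> [|L [k [n [/andP[kL Ln] jkn Pn]]]].
  by exists 0%N, 0%N.
have [Lltn|nL] := ltnP L n.
  by exists k, n; rewrite (leqW kL).
have {Ln nL} -> : L = n by apply/eqP; rewrite eqn_leq Ln.
have [m [nm jnm Pm]] := next n Pn.
by exists n, m; rewrite leqnSn.
Qed.

Definition dense_visited (Y : Type) (S : Y -> Y) (C : set Y) : Prop :=
  exists q, forall N, exists y L,
    (N <= L)%N /\ (L <= q * hits_in (visits S y C) 0 L)%N.

(** The number of visits to a closed set is upper semicontinuous: a point
outside the closed set stays outside under small perturbations. *)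
Lemma closed_hits_in (Y : topologicalType) (S : Y -> Y) (C : set Y)
    (q n m : nat) :
  continuous S -> closed C ->
  closed [set y | (m <= q * hits_in (visits S y C) 0 n)%N].
Proof.
move=> cS clC; rewrite closedE => p pA; apply: contrapT => /negP.
rewrite -ltnNge => pm; apply: pA.
have near_p (k : 'I_n) : \forall y \near p,
    visits S y C k -> visits S p C k.
  have [Ck|nCk] := pselect (visits S p C k); first exact: nearW.
  have : nbhs p (iter k S @^-1` (~` C)).
    apply: (iter_continuous cS); apply: open_nbhs_nbhs; split=> //.
    exact: closed_openC.
  by apply: filterS => y nCy /nCy.
have := @filter_forall _ _ _ _ (nbhs_filter p) near_p.
apply: filterS => y sub.
apply/negP; rewrite -ltnNge; apply: leq_ltn_trans pm.
rewrite leq_mul2l; apply/orP; right; apply: hits_in_sub => k /= kn.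
exact: (sub (Ordinal kn)).
Qed.

(** By compactness it is enough to treat segments of length at most [M]. If
every point had such a segment of frequency below 1/(2q), then any window could
be tiled by segments of this kind up to an error [M], contradicting frequency
1/q on long windows. *)
Lemma dense_visited_prefixes (Y : topologicalType) (S : Y -> Y) (C : set Y) :
  compact [set: Y] -> continuous S -> closed C -> dense_visited S C ->
  exists q y, forall n, (n <= q * hits_in (visits S y C) 0 n)%N.
Proof.
move=> cptY cS clC [q dC]; exists (2 * q)%N.
pose D M := [set y | forall n, (n <= M)%N ->
  (n <= 2 * q * hits_in (visits S y C) 0 n)%N].
have [||||y Dy] := @nested_closed_inhabited Y D.
- exact: cptY.
- move=> M; rewrite (_ : D M = \bigcap_(n in [set n | (n <= M)%N])
    [set y | (n <= 2 * q * hits_in (visits S y C) 0 n)%N]); last by [].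
  by apply: closed_bigI => n _; exact: closed_hits_in.
- move=> M; apply: contrapT => D0; have [y [L [ML Lq]]] := dC M.+1.
  pose h := hits_in (visits S y C).
  have [|||k [n [/andP[kL Ln] nkM hn]]] := @leapfrog
    (fun n => (2 * q * h 0 n <= n)%N) (fun k n => (n <= k + M)%N) _ _ _ L.
  + by rewrite /h /hits_in big_geq // muln0.
  + by move=> k; exact: leq_addr.
  + move=> k hk; apply: contrapT => nextk; apply: D0; exists (iter k S y).
    move=> n nM; rewrite leqNgt hits_in_shift; apply/negP => hkn.
    apply: nextk; exists (k + n)%N; split; [|by rewrite leq_add2l|].
      by rewrite -[X in (X < _)%N]addn0 ltn_add2l; case: n {nM} hkn.
    rewrite /h (@hits_in_cat _ 0 k) ?leq_addr // mulnDr.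
    by apply: leq_add => //; exact: ltnW.
  + have : (h 0 L <= h 0 n)%N by rewrite /h (@hits_in_cat _ 0 L n) // leq_addr.
    move: Lq; rewrite -/(h 0 L); nia.
- by move=> M y Dy n nM; apply: Dy; exact: leqW.
- by exists y => n; exact: (Dy n).
Qed.

(** For the last property, call a visit of [y] to [C] bad when it does not land
in [good]; it then starts a segment on which the visits to [C], hence the bad
visits, have frequency below 1/(2q). Jumping over these segments gives
arbitrarily long windows where the bad visits have frequency at most 1/(2q),
while all visits to [C] have frequency at least 1/q. *)
Lemma dense_visited_large (R : realType) (Y : topologicalType) (S : Y -> Y) :
  compact [set: Y] -> continuous S ->
  large_notion S (Fpubd R) (dense_visited S).
Proof.
move=> cptY cS; split.
- move=> C [q /(_ 1%N)[y [L [L1 Lq]]]]; apply: contrapT => C0.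
  have : (hits_in (visits S y C) 0 L <= hits_in set0 0 L)%N.
    by apply: hits_in_sub => k _ Ck; case: C0; eexists; exact: Ck.
  rewrite [X in (_ <= X)%N]/hits_in big1 => [|k _]; last by rewrite in_set0.
  nia.
- move=> C D clC clD [q dCD].
  have [dC|nC] := pselect (dense_visited S C); [by left|right].
  exists (2 * q)%N => N; apply: contrapT => nD; apply: nC.
  exists (2 * q)%N => M; have [y [L [NML Lq]]] := dCD (maxn N M).
  exists y, L; split; first by lia.
  rewrite leqNgt; apply/negP => hC; apply: nD; exists y, L; split; first by lia.
  have := hits_in_setU (visits S y C) (visits S y D) 0 L.
  rewrite (_ : visits S y C `|` visits S y D = visits S y (C `|` D)) //.
  nia.
- move=> C clC /(dense_visited_prefixes cptY cS clC)[q [y Cy]].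
  pose good := [set x | forall n, (n <= 2 * q * hits_in (visits S x C) 0 n)%N].
  exists (C `&` good); split.
  + apply: closedI => //.
    rewrite (_ : good = \bigcap_n
        [set x | (n <= 2 * q * hits_in (visits S x C) 0 n)%N]).
      by apply: closed_bigI => n _; exact: closed_hits_in.
    by apply/seteqP; split=> x Cx n; [move=> _|]; exact: Cx.
  + exact: subIsetl.
  + exists (2 * q)%N => N; exists y.
    pose bad := visits S y C `\` visits S y good.
    have [|||_ [L [/andP[_ NL] _ badL]]] := @leapfrog
      (fun n => (2 * q * hits_in bad 0 n <= n)%N) (fun _ _ => True) _ _ _ N.
    * by rewrite /hits_in big_geq // muln0.
    * by [].
    * move=> k badk; have [[_ ngk]|nbadk] := pselect (bad k); last first.
        exists k.+1; split=> //; rewrite (@hits_in_cat _ 0 k) //.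
        rewrite [hits_in _ k _]/hits_in big_nat1 memNset // addn0; exact: leqW.
      have /existsNP[n] := ngk; rewrite hits_in_shift => /negP.
      rewrite -ltnNge => hn.
      exists (k + n)%N; split=> //.
        by rewrite -[X in (X < _)%N]addn0 ltn_add2l; case: n hn.
      rewrite (@hits_in_cat _ 0 k) ?leq_addr // mulnDr.
      apply: leq_add => //; apply: leq_trans (ltnW hn).
      by rewrite leq_mul2l; apply/orP; right; apply: hits_in_sub => j _ [].
    * exists L; split=> //.
      have := hits_in_setU bad (visits S y (C `&` good)) 0 L.
      have -> : bad `|` visits S y (C `&` good) = visits S y C.
        apply/seteqP; split=> k; first by case=> -[].
        move=> Ck.
        by have [gk|ngk] := pselect (visits S y good k); [right|left].
      have := Cy L; nia.
  + move=> x [_ gx] U CU; apply/Fpubd_windows; exists (2 * q)%N => N.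
    exists 0%N, N; split=> //; rewrite subn0; apply: leq_trans (gx N) _.
    rewrite leq_mul2l; apply/orP; right.
    by apply: hits_in_sub => k _; exact: CU.
Qed.

(** Discarding the time 0 costs at most one visit, hence the longer windows and
the factor 2. *)
Lemma Fpubd_dense_visited (R : realType) (Y : Type) (S : Y -> Y) (K : set Y)
    (z : Y) (A : set nat) : Fpubd R A ->
  (forall k, (1 <= k)%N -> A k -> K (iter k S z)) -> dense_visited S K.
Proof.
move=> /Fpubd_windows[q winA] AK; exists (2 * q)%N => N.
have [a [b [aNb ab]]] := winA (N + q.+1)%N.
exists (iter a S z), (b - a)%N; split; first by lia.
rewrite hits_in_shift subnKC; last by lia.
have : (hits_in A a b <= 1 + hits_in (visits S z K) a b)%N.
  have h1 : (hits_in [set 0%N] a b <= 1)%N.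
    have [->|a0] := eqVneq a 0%N.
      rewrite /hits_in; case: b {aNb ab} => [|b]; first by rewrite big_geq.
      rewrite big_nat_recl // big1 ?addn0 ?leq_b1 // => i _.
      by rewrite memNset //=.
    rewrite /hits_in big_nat big1 // => i /andP[ai _].
    rewrite memNset //= => i0; by move: ai a0; rewrite i0 leqn0 => ->.
  apply: leq_trans (leq_add h1 (leqnn _)).
  apply: leq_trans (hits_in_setU _ _ _ _); apply: hits_in_sub => k _ Ak.
  by case: k Ak => [|k] Ak; [left|right; exact: AK].
move: aNb ab; case: (hits_in (visits S z K) a b) => [|h]; nia.
Qed.

Lemma Fpubd_positive (R : realType) (A : set nat) :
  Fpubd R A -> exists2 k, (1 <= k)%N & A k.
Proof.
move=> FA; apply: contrapT => nA.
(* Without positive elements, A meets the visit criterion for the empty set. *)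
have [q /(_ 1%N)[y [L [L1 Lq]]]] : @dense_visited unit id set0.
  apply: (@Fpubd_dense_visited R unit id set0 tt A FA) => k k1 Ak.
  by case: nA; exists k.
by move: Lq; rewrite /hits_in big1 => [|k _]; [lia|rewrite memNset].
Qed.

(** * The power system and its sensitive tuples *)

Section power_system.
Context {X : topologicalType} (n : nat) (T : X -> X).
Local Notation Y := {ptws 'I_n -> X}.
Hypothesis T_continuous : continuous T.

Lemma iter_power_map (k : nat) (x : Y) (i : 'I_n) :
  iter k (@power_map X n T) x i = iter k T (x i).
Proof. by elim: k => //= k <-. Qed.

Lemma power_map_continuous : continuous (@power_map X n T).
Proof.
move=> x; have FF : Filter (@power_map X n T @ nbhs x) by apply: fmap_filter.
apply/cvg_sup => i; apply: continuous_comp_initial => y.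
exact: (continuous_comp (@proj_continuous _ _ i y) (@T_continuous _)).
Qed.

Lemma nbhs_box (x : Y) (V : 'I_n -> set X) : (forall i, nbhs (x i) (V i)) ->
  nbhs x [set y : Y | forall i, V i (y i)].
Proof.
move=> xV.
apply: (@filter_forall Y _ (fun i y => V i (y i)) _ (nbhs_filter x)) => i.
exact: (@proj_continuous _ (fun=> X) i x _ (xV i)).
Qed.

Lemma power_compact : compact [set: X] -> compact [set: Y].
Proof.
move=> cX; have := @tychonoff 'I_n (fun=> X) (fun=> setT) (fun=> cX).
by congr compact; apply/seteqP.
Qed.

Definition tuple_images (U : set X) : set Y :=
  [set w | exists (y : 'I_n -> X) (m : nat),
    [/\ forall i, U (y i), (1 <= m)%N & forall i, w i = iter m T (y i)]].

(** The tuples, possibly with equal entries, that satisfy the sensitivity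
condition. Writing it with closures makes this set visibly closed, and boxes
around a tuple replace families of neighbourhoods of the entries. *)
Definition sensitive_set : set Y :=
  \bigcap_(U in [set U | open U /\ U !=set0]) closure (tuple_images U).

Lemma closed_sensitive_set : closed sensitive_set.
Proof. by apply: closed_bigI => U _; exact: closed_closure. Qed.

Lemma sensitive_set_tuple (x : Y) : sensitive_set x ->
  (exists i j, x i <> x j) -> sensitive_tuple T x.
Proof.
move=> ox xne; split=> // U oU neU V xV.
have xB : nbhs x [set y : Y | forall i, V i (y i)].
  by apply: nbhs_box => i; exact: open_nbhs_nbhs.
have [w [[y [m [Uy m1 wy]]] Vw]] := ox U (conj oU neU) _ xB.
by exists y, m; split=> // i; rewrite -wy.
Qed.

Lemma iter_sensitive_set (k : nat) (x : Y) :
  sensitive_set x -> sensitive_set (iter k (@power_map X n T) x).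
Proof.
move=> ox U oU B xB.
have xkB : nbhs x (iter k (@power_map X n T) @^-1` B).
  exact: (iter_continuous power_map_continuous).
have [w [[y [m [Uy m1 wy]]] Bw]] := ox U oU _ xkB.
exists (iter k (@power_map X n T) w); split=> //.
exists y, (k + m)%N; split=> //; first by rewrite addn_gt0 m1 orbT.
by move=> i; rewrite iter_power_map wy iterD.
Qed.

End power_system.

(** * The limit tuple of a broken sensitive system *)

Section separation.
Context {R : realType} {X : metricType R} (n : nat) (T : X -> X).
Local Notation Y := {ptws 'I_n -> X}.
Local Notation S := (@power_map X n T).
Hypothesis T_continuous : continuous T.
Local Open Scope ring_scope.

(** The matrix of [broken_sensitive], for a fixed constant and a fixed set. *)
Definition broken_along (delta : R) (A : set nat) : Prop :=
  forall U : set X, open U -> U !=set0 -> forall l : nat, (1 <= l)%N ->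
    exists (x : 'I_n -> X) (m : nat), (forall i, U (x i)) /\
      forall k : nat,
        [set (m + f)%N | f in A `&` [set f : nat | (1 <= f <= l)%N]] k ->
        forall i j : 'I_n, (i < j)%N ->
          delta < mdist (iter k T (x i)) (iter k T (x j)).

Definition separated (e : R) : set Y :=
  [set w | forall i j : 'I_n, (i < j)%N -> e <= mdist (w i) (w j)].

Lemma near_mdist (x : X) (e : R) : 0 < e -> \forall y \near x, mdist x y < e.
Proof. by move=> e0; have := nbhsx_ballx x e e0; rewrite ballEmdist. Qed.

Lemma closed_separated (e : R) : closed (separated e).
Proof.
rewrite closedE => w nearw i j ij; rewrite leNgt; apply/negP => wij.
apply: nearw; pose r := (e - mdist (w i) (w j)) / 2.
have r0 : 0 < r by rewrite /r; lra.
have := nbhs_box (fun l => near_mdist (w l) r0); apply: filterS => v vw.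
move/(_ i j ij); have vi : mdist (w i) (v i) < r := vw i.
have vj : mdist (w j) (v j) < r := vw j.
have := metric_triangle (v i) (w i) (v j).
have := metric_triangle (w i) (w j) (v j).
rewrite (metric_sym (v i) (w i)); rewrite /r in vi vj; lra.
Qed.

Lemma separated_inj (e : R) (w : Y) (i j : 'I_n) : 0 < e ->
  separated e w -> i != j -> w i <> w j.
Proof.
move=> e0 sw ij wij; wlog lt_ij : i j ij wij / (i < j)%N.
  move=> H; have [/H|/H|/val_inj eij] := ltngtP i j.
  - exact.
  - by apply=> //; rewrite eq_sym.
  - by rewrite eij eqxx in ij.
by have := sw i j lt_ij; rewrite wij mdistxx leNgt e0.
Qed.

(** The time [m] can be taken arbitrarily large: by continuity, points of a
small enough open set stay [delta]-close during the first [M + k0] steps,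
whereas they are [delta]-apart at time [m + k0] for a fixed positive [k0] in
[A]. *)
Lemma separated_late (A : set nat) (delta : R) : (2 <= n)%N -> 0 < delta ->
  (exists2 k, (1 <= k)%N & A k) ->
  broken_along delta A -> forall (U : set X) (l M : nat), open U -> U !=set0 ->
    exists (x : 'I_n -> X) (m : nat), [/\ forall i, U (x i), (M <= m)%N &
      forall f, (1 <= f <= l)%N -> A f ->
        separated delta (iter f S (fun i => iter m T (x i)))].
Proof.
move=> n2 d0 [k0 k01 Ak0] brk U l M oU [u Uu].
have e0 : 0 < delta / 2 by lra.
pose V := [set w | forall k : 'I_(M + k0),
  mdist (iter k T u) (iter k T w) < delta / 2].
have uV : nbhs u V.
  apply: (@filter_forall X _ (fun (k : 'I_(M + k0)) w =>
    mdist (iter k T u) (iter k T w) < delta / 2) _ (nbhs_filter u)) => k.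
  exact: (@iter_continuous _ _ k T_continuous u _ (near_mdist _ e0)).
have [|||x [m [UVx sep]]] := brk (U `&` interior V) _ _ (maxn l k0).
- by apply: openI => //; exact: open_interior.
- by exists u.
- by rewrite leq_max k01 orbT.
exists x, m; split.
- by move=> i; have [] := UVx i.
- rewrite leqNgt; apply/negP => mM.
  pose i0 := Ordinal (ltnW n2); pose i1 := Ordinal n2.
  have mk : (m + k0 < M + k0)%N by rewrite ltn_add2r.
  have close i : mdist (iter (m + k0) T u) (iter (m + k0) T (x i)) < delta / 2.
    by have [_ /interior_subset/(_ (Ordinal mk))] := UVx i.
  have := metric_triangle (iter (m + k0) T (x i0)) (iter (m + k0) T u)
    (iter (m + k0) T (x i1)).
  rewrite (metric_sym (iter (m + k0) T (x i0)) (iter (m + k0) T u)).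
  have c0 := close i0; have c1 := close i1 => tri.
  have in_window : [set (m + f)%N | f in
      A `&` [set f : nat | (1 <= f <= maxn l k0)%N]] (m + k0)%N.
    by exists k0 => //; split=> //=; rewrite k01 leq_maxr.
  by have := sep _ in_window i0 i1 isT; lra.
- move=> f /andP[f1 fl] Af i j ij; rewrite !iter_power_map -!iterD addnC ltW //.
  apply: sep => //; exists f => //; split=> //=.
  by rewrite f1 leq_max fl.
Qed.

(** The sets [Z (U, (l, M))] of the images, at a time larger than [M], of tuples
of [U] that are separated along [A] up to [l], form a filter base. Indeed, by
transitivity some [T^j] maps a nonempty open part of [U] into [U']; an image at
time [m > M' + j] of a tuple [x] in that part is also the image at time [m - j >
M'] of the tuple [T^j x] in [U']. The tuple sought is a cluster point of that
filter. *)
Lemma broken_limit_tuple (A : set nat) (delta : R) : (2 <= n)%N -> 0 < delta ->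
  [set: X] !=set0 -> compact [set: X] -> transitive_system T ->
  (exists2 k, (1 <= k)%N & A k) ->
  broken_along delta A ->
  exists2 z : Y, sensitive_set T z &
    forall k, (1 <= k)%N -> A k -> separated delta (iter k S z).
Proof.
move=> n2 d0 neX cX trT neA brk.
have late := separated_late n2 d0 neA brk.
pose D := [set p : set X * (nat * nat) | open p.1 /\ p.1 !=set0].
pose Z (p : set X * (nat * nat)) : set Y := [set z | exists x m,
  [/\ forall i, p.1 (x i), (p.2.2 < m)%N, forall i, z i = iter m T (x i) &
    forall f, (1 <= f <= p.2.1)%N -> A f -> separated delta (iter f S z)]].
have ZF : ProperFilter (filter_from D Z).
  apply: filter_from_proper.
    apply: filter_from_filter.
      by exists (setT, (0, 0))%N; split=> //; exact: openT.
    move=> [U [l M]] [U' [l' M']] [/= oU neU] [/= oU' neU'].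
    have [j [u [Uu U'u]]] : [set k | (U `&` iter k T @^-1` U') !=set0] !=set0.
      by apply: infinite_setN0; exact: trT.
    exists (U `&` iter j T @^-1` U', (maxn l l', maxn M (M' + j))%N).
      split=> /=; last by exists u.
      apply: openI => //; apply: open_comp => // y _.
      exact: iter_continuous.
    move=> z [x [m [/= Ux Mm zx sep]]]; split.
      exists x, m; split=> //=.
      - by move=> i; case: (Ux i).
      - by lia.
      - by move=> f fl; apply: sep; lia.
    exists (fun i => iter j T (x i)), (m - j)%N; split=> //=.
    - by move=> i; case: (Ux i).
    - by lia.
    - by move=> i; rewrite -iterD subnK //; lia.
    - by move=> f fl; apply: sep; lia.
  move=> [U [l M]] [/= oU neU].
  have [x [m [Ux Mm sep]]] := late U l M.+1 oU neU.
  by exists (fun i => iter m T (x i)), x, m; split.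
have [z [_ clz]] := power_compact (n := n) cX ZF filterT.
exists z.
  move=> U oU B zB; apply: clz zB; exists (U, (0, 0))%N => //.
  by move=> w [x [m [Ux m1 wx _]]]; exists x, m.
move=> k k1 Ak; apply: (closed_separated (e := delta)) => B zB.
have zkB : nbhs z (iter k S @^-1` B).
  exact: (iter_continuous (power_map_continuous (n := n) T_continuous)).
have [|w [Zw Bw]] := clz (Z (setT, (k, 0))%N) _ _ zkB.
  by exists (setT, (k, 0))%N => //; split=> //; exact: openT.
exists (iter k S w); split=> //.
by have [x [m [_ _ _ /(_ k)]]] := Zw; rewrite k1 leqnn; exact.
Qed.

End separation.

(** * The two implications *)

Section main.
Context {R : realType} {X : metricType R} (n : nat) (T : X -> X).
Local Notation Y := {ptws 'I_n -> X}.
Local Open Scope ring_scope.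

Lemma distinct_gap (x : 'I_n -> X) : (forall i j, i != j -> x i <> x j) ->
  exists2 e : R, 0 < e & forall i j : 'I_n, i != j -> e <= mdist (x i) (x j).
Proof.
move=> x_inj; exists (\big[Order.min/1]_(p : 'I_n * 'I_n | p.1 != p.2)
    mdist (x p.1) (x p.2)).
  apply: lt_bigmin => [|[i j] /= ij]; first exact: ltr01.
  by rewrite mdist_gt0; apply/eqP; exact: x_inj.
by move=> i j ij; apply: (bigmin_le_cond _ (j := (i, j))).
Qed.

Lemma recurrent_broken (F : set (set nat)) (x : Y) : continuous T ->
  essential_sensitive_tuple T x -> recurrent_point F (@power_map X n T) x ->
  broken_sensitive T F n.
Proof.
move=> cT [[_ sens] x_inj] rec; have [e e0 xe] := distinct_gap x_inj.
(* Two orbits that stay d-close to points at distance 3 d are d-apart. *)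
pose d := e / 3; have d0 : 0 < d by rewrite /d; lra.
pose A : set nat := [set k | forall i, mdist (x i) (iter k T (x i)) < d].
exists d, A; split=> //.
  have := rec _ (nbhs_box (fun i => near_mdist (x i) d0)).
  congr F; apply/seteqP; split=> k /= Ak i; have := Ak i;
    by rewrite iter_power_map.
move=> U oU neU l l1.
pose V i := [set y | forall k : 'I_l.+1,
  A k -> mdist (x i) (iter k T y) < d].
have xV i : nbhs (x i) (V i).
  apply: (@filter_forall X _ (fun (k : 'I_l.+1) y =>
    A k -> mdist (x i) (iter k T y) < d) _ (nbhs_filter (x i))) => k.
  have [Ak|nAk] := pselect (A k); last by apply: nearW => y /nAk.
  pose r := d - mdist (x i) (iter k T (x i)).
  have r0 : 0 < r by have := Ak i; rewrite /r; lra.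
  have : \forall y \near x i, mdist (iter k T (x i)) (iter k T y) < r.
    exact: (@iter_continuous _ _ k cT (x i) _ (near_mdist _ r0)).
  apply: filterS => y /= kxy _.
  have := metric_triangle (x i) (iter k T (x i)) (iter k T y).
  by rewrite /r in kxy; lra.
have [|y [m [Uy _ Vy]]] := sens U oU neU (fun i => interior (V i)).
  by move=> i; split; [exact: open_interior|exact: xV].
exists y, m; split=> // _ [f [Af /andP[f1 fl]] <-] i j ij.
have near_x i' : mdist (x i') (iter (m + f) T (y i')) < d.
  rewrite addnC iterD; have fl' : (f < l.+1)%N by [].
  exact: (interior_subset (Vy i') (Ordinal fl')).
have := xe i j; rewrite neq_ltn ij => /(_ isT).
have := metric_triangle (x i) (iter (m + f) T (y i)) (x j).
have := metric_triangle (iter (m + f) T (y i)) (iter (m + f) T (y j)) (x j).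
rewrite (metric_sym (iter (m + f) T (y j)) (x j)).
have := near_x i; have := near_x j; rewrite /d; lra.
Qed.

(** The large set is the set of separated tuples satisfying the sensitivity
condition; the tuple of [broken_limit_tuple] visits it along [A]. *)
Lemma broken_recurrent (F : set (set nat)) (P : set Y -> Prop) : (2 <= n)%N ->
  [set: X] !=set0 -> compact [set: X] -> continuous T -> transitive_system T ->
  (forall A, F A -> exists2 k, (1 <= k)%N & A k) ->
  large_notion (@power_map X n T) F P ->
  (forall K z A, F A ->
    (forall k, (1 <= k)%N -> A k -> K (iter k (@power_map X n T) z)) -> P K) ->
  broken_sensitive T F n -> exists x : Y,
    essential_sensitive_tuple T x /\ recurrent_point F (@power_map X n T) x.
Proof.
move=> n2 neX cX cT trT F_pos largeP visitP [delta [A [d0 FA brk]]].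
have [z oz sepz] := broken_limit_tuple cT n2 d0 neX cX trT (F_pos A FA) brk.
have [||x [ox sepx] recx] := @large_recurrent R Y (@power_map X n T) F P
  (power_compact cX) largeP (sensitive_set T `&` separated delta).
- by apply: closedI; [exact: closed_sensitive_set|exact: closed_separated].
- apply: (visitP _ z A FA) => k k1 Ak.
  by split; [exact: iter_sensitive_set|exact: sepz].
exists x; split=> //.
have x_inj i j : i != j -> x i <> x j by exact: separated_inj sepx.
split=> //; apply: sensitive_set_tuple => //.
by exists (Ordinal (ltnW n2)), (Ordinal n2); exact: x_inj.
Qed.

End main.

Local Open Scope ring_scope.

Theorem theorem1 (R : realType) (X : metricType R) (T : X -> X)
    (n : nat) (F : set (set nat))
    (X_nonempty : [set: X] !=set0)
    (T_system : is_system T)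
    (T_transitive : transitive_system T)
    (n_ge2 : (2 <= n)%N)
    (F_family : F = Fps \/ F = Fpubd R) :
  broken_sensitive T F n <->
  exists x : {ptws 'I_n -> X},
    essential_sensitive_tuple T x /\
    recurrent_point F (@power_map X n T) x.
Proof.
have [cX cT _] := T_system; split=> [|[x [ess rec]]]; last first.
  exact: recurrent_broken ess rec.
have cY := power_compact (n := n) cX.
have cS : continuous (@power_map X n T) by exact: power_map_continuous.
case: F_family => ->.
- apply: (broken_recurrent (P := ps_visited (@power_map X n T))) => //.
  + exact: Fps_positive.
  + exact: ps_visited_large.
  + by move=> K z A; exact: Fps_ps_visited.
- apply: (broken_recurrent (P := dense_visited (@power_map X n T))) => //.
  + exact: Fpubd_positive.
  + exact: dense_visited_large.
  + by move=> K z A; exact: Fpubd_dense_visited.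
Qed.
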